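(* Let $\Sigma$ be a discrete asymptotic net in $\mathbb{P}^3$. Then $\Sigma$ admits a canonical frame, that is, homogeneous coordinates $r:\mathbb{Z}^2\to\mathbb{R}^4$ of $\Sigma$ and scalar functions $\alpha,\bar\alpha$ on $\mathbb{Z}^2$ can be chosen such that, with $\gamma$ defined by either of the relations $$\bar\alpha_1=\frac{\gamma}{\alpha},\qquad \alpha_2=\frac{\gamma}{\bar\alpha}$$ (so that $\gamma=\alpha\bar\alpha_1=\bar\alpha\alpha_2$), the frame $$F=\begin{pmatrix} r\\ r^1\\ r^2\\ r^{12}\end{pmatrix}=\begin{pmatrix} r\\ \alpha r_1\\ \bar\alpha r_2\\ \gamma r_{12}\end{pmatrix}$$ satisfies, for some scalar functions $u,v,a,b,\bar u,\bar v,\bar a,\bar b$ on $\mathbb{Z}^2$, the discrete projective Gauss-Weingarten equations $$F_1=LF,\quad L=\begin{pmatrix}0&1/\alpha&0&0\\ -\alpha&u&0&b\\ 0&0&0&1/\alpha\\ 0&a&-\alpha&v\end{pmatrix},\qquad F_2=MF,\quad M=\begin{pmatrix}0&0&1/\bar\alpha&0\\ 0&0&0&1/\bar\alpha\\ -\bar\alpha&0&\bar u&\bar b\\ 0&-\bar\alpha&\bar a&\bar v\end{pmatrix},$$ and the quadrics $$Q=r^{12}+\mu r^1+\nu r^2+\mu\nu r$$ (one for each quadrilateral, with $\mu,\nu$ parametrising the two families of generators of the quadric) constitute a lattice of Lie quadrics $\{Q\}$ associated with $\Sigma$.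
   Context: Notation: for a function $h$ on $\mathbb{Z}^2$ with variables $(n_1,n_2)$, subscripts $1,2$ denote shifts, $h_1(n_1,n_2)=h(n_1+1,n_2)$, $h_2(n_1,n_2)=h(n_1,n_2+1)$, $h_{12}$ denotes both shifts, and $h_{\bar 1},h_{\bar 2}$ denote the inverse shifts. The superscripts in $r^1,r^2,r^{12}$ are labels, not shifts. Bars on letters such as $\bar a$ merely distinguish functions. A discrete surface $\Sigma$ in the real projective space $\mathbb{P}^3$ is a lattice of $\mathbb{Z}^2$ combinatorics in $\mathbb{P}^3$, represented by homogeneous coordinates $r:\mathbb{Z}^2\to\mathbb{R}^4$. Homogeneous coordinates may be rescaled by a non-zero scalar at each vertex. $\Sigma$ is a discrete asymptotic net if, for every vertex, the points $r,r_1,r_2,r_{\bar1},r_{\bar2}$ of $\mathbb{P}^3$ are coplanar. All discrete asymptotic nets are assumed generic in the sense that their quadrilaterals $[r,r_1,r_2,r_{12}]$ are non-planar, i.e. $r,r_1,r_2,r_{12}$ are linearly independent. The quadrics passing through the four (extended) edges $(r,r_1),(r,r_2),(r_1,r_{12}),(r_2,r_{12})$ of a quadrilateral form a one-parameter family; they are said to be associated with the quadrilateral. Two quadrics associated with two neighbouring quadrilaterals (sharing an edge) have the $\mathcal{C}^1$ property if their tangent planes coincide at each point of the common edge. A lattice of Lie quadrics associated with $\Sigma$ is a set of quadrics associated with the quadrilaterals of $\Sigma$ (one for each quadrilateral) such that any two neighbouring quadrics have the $\mathcal{C}^1$ property. The same symbol $Q$ is used for a quadric and its representation in homogeneous coo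rdinates.
   Formalization: Real coordinates and scalars need not exist for every net; they are obtained when at each vertex the edge lines to r_1, r_{-1} do not separate those to r_2, r_{-2} (a necessary condition). For all nets the frame is given with complex scalars and real Lie quadrics. *)

(* Defs.v *)
From HB Require Import structures.
From mathcomp Require Import all_boot all_order all_algebra.
From mathcomp Require Import reals.
From mathcomp Require Export complex.

Set Implicit Arguments.
Unset Strict Implicit.
Unset Printing Implicit Defensive.

Import Order.TTheory GRing.Theory Num.Theory.
Local Open Scope ring_scope.

Definition lattice (T : Type) : Type := int -> int -> T.

Definition sh1 (T : Type) (h : lattice T) : lattice T :=
  fun n1 n2 => h (n1 + 1) n2.
Definition sh2 (T : Type) (h : lattice T) : lattice T :=
  fun n1 n2 => h n1 (n2 + 1).
Definition bk1 (T : Type) (h : lattice T) : lattice T :=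
  fun n1 n2 => h (n1 - 1) n2.
Definition bk2 (T : Type) (h : lattice T) : lattice T :=
  fun n1 n2 => h n1 (n2 - 1).
Definition sh12 (T : Type) (h : lattice T) : lattice T := sh1 (sh2 h).

(* The 4 x 4 matrix given by the list of its rows, each a list of entries. *)
Definition mx4 (K : fieldType) (s : seq (seq K)) : 'M[K]_4 :=
  \matrix_(i, j) (nth [::] s i)`_j.

Definition rows4 (K : fieldType) (x y z w : 'rV[K]_4) : 'M[K]_4 :=
  \matrix_(i < 4) nth 0 [:: x; y; z; w] i.

(* A point of projective 3-space is represented by a non-zero row vector, and
   a discrete surface by one representative per vertex.  The span of points is
   the sum of row spaces, so coplanarity is a rank of at most 3.
   Representatives of a net are non-zero because its quadrilaterals are
   non-planar. *)
Definition nonplanar_quadrilateral (K : fieldType) (s : lattice 'rV[K]_4)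
    (n1 n2 : int) : Prop :=
  row_free (rows4 (s n1 n2) (sh1 s n1 n2) (sh2 s n1 n2) (sh12 s n1 n2)).

Definition coplanar_star (K : fieldType) (s : lattice 'rV[K]_4)
    (n1 n2 : int) : Prop :=
  (\rank (s n1 n2 + sh1 s n1 n2 + sh2 s n1 n2 + bk1 s n1 n2 + bk2 s n1 n2)%MS
     <= 3)%N.

Definition discrete_asymptotic_net (K : fieldType) (s : lattice 'rV[K]_4)
    : Prop :=
  forall n1 n2 : int, coplanar_star s n1 n2 /\ nonplanar_quadrilateral s n1 n2.

(* A quadric is represented by a non-zero symmetric matrix S, the point x lying
   on it when x S x^T = 0. *)
Definition is_quadric (K : fieldType) (S : 'M[K]_4) : Prop :=
  S != 0 /\ S^T = S.

Definition on_quadric (K : fieldType) (S : 'M[K]_4) (x : 'rV[K]_4) : Prop :=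
  x *m S *m x^T = 0.

Definition passes_through_line (K : fieldType) (S : 'M[K]_4) (x y : 'rV[K]_4)
    : Prop :=
  forall z : 'rV[K]_4, (z <= x + y)%MS -> on_quadric S z.

Definition associated_quadric (K : fieldType) (s : lattice 'rV[K]_4)
    (n1 n2 : int) (S : 'M[K]_4) : Prop :=
  is_quadric S /\
  [/\ passes_through_line S (s n1 n2) (sh1 s n1 n2),
      passes_through_line S (s n1 n2) (sh2 s n1 n2),
      passes_through_line S (sh1 s n1 n2) (sh12 s n1 n2)
    & passes_through_line S (sh2 s n1 n2) (sh12 s n1 n2)].

Definition in_tangent_plane (K : fieldType) (S : 'M[K]_4) (x y : 'rV[K]_4)
    : Prop :=
  x *m S *m y^T = 0.

(* The conditions x *m S != 0 and x *m S' != 0 say that the tangent planes at x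
   exist, i.e. that x is not a singular point of either quadric. *)
Definition C1_along (K : fieldType) (S S' : 'M[K]_4) (p q : 'rV[K]_4) : Prop :=
  forall x : 'rV[K]_4, x != 0 -> (x <= p + q)%MS ->
    [/\ x *m S != 0, x *m S' != 0
      & forall y, in_tangent_plane S x y <-> in_tangent_plane S' x y].

Definition lattice_of_Lie_quadrics (K : fieldType) (s : lattice 'rV[K]_4)
    (Q : lattice 'M[K]_4) : Prop :=
  forall n1 n2 : int,
  [/\ associated_quadric s n1 n2 (Q n1 n2),
      C1_along (Q n1 n2) (sh1 Q n1 n2) (sh1 s n1 n2) (sh12 s n1 n2)
    & C1_along (Q n1 n2) (sh2 Q n1 n2) (sh2 s n1 n2) (sh12 s n1 n2)].

(* S is the quadric r12 + mu r1 + nu r2 + mu nu r.  Since mu and nu parametrise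
   complete families of generators, each runs over a projective line:
   mu = m0 / m1 and nu = n0 / n1, infinity included.  The pairs (m0, m1) and
   (n0, n1) are automatically non-zero because x is. *)
Definition parametrised_quadric (K : fieldType) (r r1 r2 r12 : 'rV[K]_4)
    (S : 'M[K]_4) : Prop :=
  forall x : 'rV[K]_4, x != 0 ->
    (on_quadric S x <->
     exists m0 m1 n0 n1 : K,
       x = (m1 * n1) *: r12 + (m0 * n1) *: r1 + (m1 * n0) *: r2
           + (m0 * n0) *: r).

Definition Lmx (K : fieldType) (alpha u v a b : K) : 'M[K]_4 :=
  mx4 [:: [:: 0; 1 / alpha; 0; 0];
          [:: - alpha; u; 0; b];
          [:: 0; 0; 0; 1 / alpha];
          [:: 0; a; - alpha; v]].

Definition Mmx (K : fieldType) (alpha' u' v' a' b' : K) : 'M[K]_4 :=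
  mx4 [:: [:: 0; 0; 1 / alpha'; 0];
          [:: 0; 0; 0; 1 / alpha'];
          [:: - alpha'; 0; u'; b'];
          [:: 0; - alpha'; a'; v']].

Definition gauss_weingarten (K : fieldType) (F : lattice 'M[K]_4)
    (alpha alpha' : lattice K) : Prop :=
  exists u v a b u' v' a' b' : lattice K, forall n1 n2 : int,
    sh1 F n1 n2 =
      Lmx (alpha n1 n2) (u n1 n2) (v n1 n2) (a n1 n2) (b n1 n2) *m F n1 n2 /\
    sh2 F n1 n2 =
      Mmx (alpha' n1 n2) (u' n1 n2) (v' n1 n2) (a' n1 n2) (b' n1 n2)
        *m F n1 n2.

(* r is a choice of homogeneous coordinates, with entries in K, of the surface
   represented by s. *)
Definition homogeneous_coordinates (R K : fieldType) (phi : {rmorphism R -> K})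
    (s : lattice 'rV[R]_4) (r : lattice 'rV[K]_4) : Prop :=
  exists lambda : lattice K, forall n1 n2 : int,
    lambda n1 n2 != 0 /\
    r n1 n2 = lambda n1 n2 *: map_mx phi (s n1 n2).

(* The surface s has a canonical frame with scalars in the extension
   phi : R -> K of its ground field.  The lattice of Lie quadrics Q is always
   defined over R; with phi the identity everything is. Primed letters are the
   barred letters of the equations. *)
Definition admits_canonical_frame (R K : fieldType) (phi : {rmorphism R -> K})
    (s : lattice 'rV[R]_4) : Prop :=
  exists (r : lattice 'rV[K]_4) (alpha alpha' gamma : lattice K),
    let r1 n1 n2 := alpha n1 n2 *: sh1 r n1 n2 in
    let r2 n1 n2 := alpha' n1 n2 *: sh2 r n1 n2 in
    let r12 n1 n2 := gamma n1 n2 *: sh12 r n1 n2 in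
    let F n1 n2 := rows4 (r n1 n2) (r1 n1 n2) (r2 n1 n2) (r12 n1 n2) in
    [/\ homogeneous_coordinates phi s r,
        forall n1 n2, alpha n1 n2 != 0 /\ alpha' n1 n2 != 0,
        forall n1 n2, sh1 alpha' n1 n2 = gamma n1 n2 / alpha n1 n2 /\
                      sh2 alpha n1 n2 = gamma n1 n2 / alpha' n1 n2,
        gauss_weingarten F alpha alpha'
      & exists Q : lattice 'M[R]_4,
          lattice_of_Lie_quadrics s Q /\
          forall n1 n2,
            parametrised_quadric (r n1 n2) (r1 n1 n2) (r2 n1 n2) (r12 n1 n2)
              (map_mx phi (Q n1 n2))].

(* In the tangent plane at each vertex x, the pair of lines joining x to x_1
   and x_{-1} does not separate, in the pencil of lines through x, the pair
   joining x to x_2 and x_{-2}.  Indeed, modulo x, and with [,] a determinant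
   on the tangent plane, p = [x_1, x_2] / [x_{-1}, x_2] and
   q = [x_1, x_{-2}] / [x_{-1}, x_{-2}], so p / q is the cross-ratio of the
   four lines.  A canonical frame with real scalars satisfies
   p / q = (gamma / (alpha alpha'))^2 at the vertex r_12, so this condition is
   necessary for it, and nets need not satisfy it. *)
Definition nonseparating_stars (R : realFieldType) (s : lattice 'rV[R]_4)
    : Prop :=
  forall n1 n2 : int, exists p q : R,
  [/\ 0 < p * q,
      (sh1 s n1 n2 - p *: bk1 s n1 n2 <= s n1 n2 + sh2 s n1 n2)%MS
    & (sh1 s n1 n2 - q *: bk1 s n1 n2 <= s n1 n2 + bk2 s n1 n2)%MS].

(* Main.v *)
Require Import Defs.
From HB Require Import structures.
From mathcomp Require Import all_boot all_order all_algebra.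
From mathcomp Require Import reals complex.
From mathcomp Require Import ring.

Set Implicit Arguments.
Unset Strict Implicit.
Unset Printing Implicit Defensive.

Import Order.TTheory GRing.Theory Num.Theory.
Local Open Scope ring_scope.

(** Write s for the given representatives and let lower indices denote shifts.
    The star at s_1 being planar, the vector s_11 has no component along s_2 in
    the basis s, s_1, s_2, s_12; the star at s_12 being planar, s_112 has no
    component along s.  What matters about the net is the coefficient a of s in
    s_11, the coefficient b of s_2 in s_112, and their analogues a', b' for the
    other lattice direction; all four are non-zero because the neighbouring
    quadrilaterals are non-planar.  Computing s_112, s_122 and s_1122 in two
    ways gives
        a_2 b' = a'_1 b   and   b_2 a' = b'_1 a     (gauss_compatibility),
    and these two identities drive everything else.

    Lie quadrics.  In the coordinates z0, ..., z3 of that basis the quadrics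
    through the four edges are z0 z3 = k z1 z2.  Comparing tangent planes along
    the edges shared with the two following quadrilaterals, the C1 property
    reads k k_1 b = a and k k_2 b' = a' (edge_quadric_C1).  The identities above
    say that this system is flat, so it has a solution k over the ground field
    (Lie_quadrics_exist).

    Frame.  Put r = lambda s and gamma = alpha beta / d, where beta is the
    primed alpha.  The Gauss-Weingarten equations prescribe only the
    coefficients of r in r_11 and r_22, of r_2 in r_112 and of r_1 in r_122, and
    the quadric spanned by the frame is the given one as soon as
    lambda lambda_12 = k d lambda_1 lambda_2.  Together with
    gamma = alpha beta_1 = beta alpha_2 these conditions force d^2 = b / a_2,
    which is also b' / a'_1.  Conversely, once a square root d of b / a_2 is
    chosen at every vertex, with arbitrary signs, the remaining equations for
    alpha, beta and lambda reduce to multiplicative first-order systems that are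
    flat by the C1 equations for k (frame_scalars).  Over the complex numbers d
    always exists; over the reals it does when b / a_2 is positive.  This
    quotient is a cross-ratio of the star at s_12, and its positivity is exactly
    the non-separation condition (nonseparating_gt0). *)

(** * Flat systems of difference equations on the lattice *)

Lemma int_shift_ind (P : int -> Prop) :
  P 0 -> (forall n, P n <-> P (n + 1)) -> forall n, P n.
Proof.
move=> P0 PS; elim/int_rect=> // n; first by rewrite intS addrC => /PS.
by move=> Pn; apply/PS; rewrite intS opprD addrC addrA subrr add0r.
Qed.

(** A recurrence over all integers needs its steps to be invertible; the steps
    used below divide by their argument or multiply by a non-zero scalar, so
    they are inverted only on the subset of non-zero scalars, the D of the next
    lemmas. *)
Definition orbit_from (T : Type) (step back : int -> T -> T) (x0 : T) (n : int) : T :=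
  match n with
  | Posz k => iteri k (fun i => step i%:Z) x0
  | Negz k => iteri k.+1 (fun i => back (Negz i)) x0
  end.

Lemma orbit_from_stable (T : Type) (D : T -> Prop) (step back : int -> T -> T) x0 n :
    (forall n x, D x -> D (step n x)) -> (forall n x, D x -> D (back n x)) ->
  D x0 -> D (orbit_from step back x0 n).
Proof. by move=> stepD backD Dx0; case: n => n; elim: n => [|n IHn] /=; auto. Qed.

Lemma orbit_from_shift (T : Type) (D : T -> Prop) (step back : int -> T -> T) x0 n :
    (forall n x, D x -> D (step n x)) -> (forall n x, D x -> D (back n x)) ->
    (forall n x, D x -> step n (back n x) = x) ->
  D x0 ->
  orbit_from step back x0 (n + 1) = step n (orbit_from step back x0 n).
Proof.
move=> stepD backD backK Dx0.
case: n => [k|[|k]]; first by rewrite -PoszD addn1.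
  by rewrite -[LHS]/x0 /= backK.
have -> : Negz k.+1 + 1 = Negz k by rewrite !NegzE !intS; ring.
rewrite [in RHS]/= backK //.
exact: (orbit_from_stable (Negz k) stepD backD).
Qed.

(** The section is transported along the axis n2 = 0 first and then along each
    vertical line.  Flatness carries the horizontal equation from one row to the
    next, and, the vertical steps being injective, also to the previous one. *)
Lemma flat_section (T : Type) (D : T -> Prop)
    (step1 back1 step2 back2 : int -> int -> T -> T) (x0 : T) :
    (forall n1 n2 x, D x -> [/\ D (step1 n1 n2 x), D (back1 n1 n2 x)
       & step1 n1 n2 (back1 n1 n2 x) = x]) ->
    (forall n1 n2 x, D x -> [/\ D (step2 n1 n2 x), D (back2 n1 n2 x),
       step2 n1 n2 (back2 n1 n2 x) = x & back2 n1 n2 (step2 n1 n2 x) = x]) ->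
    (forall n1 n2 x, D x -> step2 (n1 + 1) n2 (step1 n1 n2 x)
                            = step1 n1 (n2 + 1) (step2 n1 n2 x)) ->
    D x0 ->
  exists h : lattice T, forall n1 n2, [/\ D (h n1 n2),
    h (n1 + 1) n2 = step1 n1 n2 (h n1 n2)
    & h n1 (n2 + 1) = step2 n1 n2 (h n1 n2)].
Proof.
move=> D1 D2 flat Dx0.
pose h0 := orbit_from (step1^~ 0) (back1^~ 0) x0.
pose h n1 n2 := orbit_from (step2 n1) (back2 n1) (h0 n1) n2.
have h0D n1 : D (h0 n1).
  by apply: (orbit_from_stable (D := D)) => // n x /(D1 n 0)[].
have hD n1 n2 : D (h n1 n2).
  by apply: (orbit_from_stable (D := D)) => // n x /(D2 n1 n)[].
have h2 n1 n2 : h n1 (n2 + 1) = step2 n1 n2 (h n1 n2).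
  by apply: (@orbit_from_shift _ D) => // n x /(D2 n1 n)[].
exists h => n1 n2; split=> //; move: n2; apply: int_shift_ind.
  by apply: (@orbit_from_shift _ D) => // n x /(D1 n 0)[].
move=> n2; have hDn := hD n1 n2; split=> [IHn|].
  by rewrite !h2 IHn flat.
rewrite !h2 -flat // => eq2.
have [_ _ _ <-] := D2 (n1 + 1) n2 _ (hD (n1 + 1) n2).
by rewrite eq2; case: (D1 n1 n2 _ hDn) => /(D2 (n1 + 1) n2)[].
Qed.

Lemma multiplicative_potential (K : fieldType) (X Y : lattice K) :
    (forall n1 n2, X n1 n2 != 0) -> (forall n1 n2, Y n1 n2 != 0) ->
    (forall n1 n2, Y (n1 + 1) n2 * X n1 n2 = X n1 (n2 + 1) * Y n1 n2) ->
  exists h : lattice K, forall n1 n2, [/\ h n1 n2 != 0,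
    h (n1 + 1) n2 = X n1 n2 * h n1 n2 & h n1 (n2 + 1) = Y n1 n2 * h n1 n2].
Proof.
move=> X0 Y0 flat.
apply: (@flat_section K (fun x => x != 0 : Prop)
  (fun n1 n2 x => X n1 n2 * x) (fun n1 n2 x => (X n1 n2)^-1 * x)
  (fun n1 n2 x => Y n1 n2 * x) (fun n1 n2 x => (Y n1 n2)^-1 * x) 1).
- by move=> n1 n2 x x0; split; rewrite ?mulf_neq0 ?invr_eq0 ?mulVKf.
- by move=> n1 n2 x x0; split; rewrite ?mulf_neq0 ?invr_eq0 ?mulVKf ?mulKf.
- by move=> n1 n2 x _; rewrite !mulrA flat.
- exact: oner_neq0.
Qed.

(** A product of neighbours is prescribed, so the step is x |-> X / x, its own
    inverse; the compatibility of the two directions is again a flatness. *)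
Lemma alternating_potential (K : fieldType) (X Y : lattice K) :
    (forall n1 n2, X n1 n2 != 0) -> (forall n1 n2, Y n1 n2 != 0) ->
    (forall n1 n2, Y (n1 + 1) n2 * Y n1 n2 = X n1 (n2 + 1) * X n1 n2) ->
  exists h : lattice K, forall n1 n2, [/\ h n1 n2 != 0,
    h n1 n2 * h (n1 + 1) n2 = X n1 n2 & h n1 n2 * h n1 (n2 + 1) = Y n1 n2].
Proof.
move=> X0 Y0 flat.
have divDK (x y : K) : x != 0 -> y != 0 -> x / (x / y) = y.
  by move=> x0 y0; rewrite invf_div mulrC divfK.
have [||||h hP] := @flat_section K (fun x => x != 0 : Prop)
  (fun n1 n2 x => X n1 n2 / x) (fun n1 n2 x => X n1 n2 / x)
  (fun n1 n2 x => Y n1 n2 / x) (fun n1 n2 x => Y n1 n2 / x) 1.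
- by move=> n1 n2 x x0; split; rewrite ?mulf_neq0 ?invr_eq0 ?divDK.
- by move=> n1 n2 x x0; split; rewrite ?mulf_neq0 ?invr_eq0 ?divDK.
- move=> n1 n2 x x0; rewrite !invf_div ![_ * (x / _)]mulrCA; congr (_ * _).
  by apply/eqP; rewrite eqr_div //; apply/eqP.
- exact: oner_neq0.
exists h => n1 n2; case: (hP n1 n2) => h0 -> ->.
by split; rewrite // mulrC divfK.
Qed.

(** * Four independent points as a basis *)

Definition comb4 (K : fieldType) (x y z w : 'rV[K]_4) (c0 c1 c2 c3 : K) :
    'rV[K]_4 :=
  c0 *: x + c1 *: y + c2 *: z + c3 *: w.

Lemma mul_rows4 (K : fieldType) (c x y z w : 'rV[K]_4) :
  c *m rows4 x y z w = comb4 x y z w (c 0 (inord 0)) (c 0 (inord 1))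
    (c 0 (inord 2)) (c 0 (inord 3)).
Proof.
rewrite mulmx_sum_row !big_ord_recl big_ord0 addr0 !rowK /= !addrA.
by congr (c 0 _ *: _ + c 0 _ *: _ + c 0 _ *: _ + c 0 _ *: _);
  apply/val_inj; rewrite /= inordK.
Qed.

Lemma mx4_mul_rows4 (K : fieldType) (s : seq (seq K)) (x y z w : 'rV[K]_4) :
  let row_comb r := comb4 x y z w r`_0 r`_1 r`_2 r`_3 in
  mx4 s *m rows4 x y z w =
  rows4 (row_comb (nth [::] s 0)) (row_comb (nth [::] s 1))
        (row_comb (nth [::] s 2)) (row_comb (nth [::] s 3)).
Proof.
move=> row_comb; apply/row_matrixP => i; rewrite row_mul mul_rows4 !mxE !inordK // rowK.
by case: i => [[|[|[|[|i]]]] lti].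
Qed.

Lemma comb4_inj (K : fieldType) (x y z w : 'rV[K]_4) (b0 b1 b2 b3 c0 c1 c2 c3 : K) :
    row_free (rows4 x y z w) ->
    comb4 x y z w b0 b1 b2 b3 = comb4 x y z w c0 c1 c2 c3 ->
  [/\ b0 = c0, b1 = c1, b2 = c2 & b3 = c3].
Proof.
pose v (d0 d1 d2 d3 : K) := \row_(j < 4) [:: d0; d1; d2; d3]`_j.
have vE d0 d1 d2 d3 : comb4 x y z w d0 d1 d2 d3 = v d0 d1 d2 d3 *m rows4 x y z w.
  by rewrite mul_rows4 !mxE !inordK.
move=> free; rewrite !vE => /(row_free_inj free)/rowP eqv.
by split; [have := eqv (inord 0)|have := eqv (inord 1)|have := eqv (inord 2)
          |have := eqv (inord 3)]; rewrite !mxE !inordK.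
Qed.

Lemma comb4_span (K : fieldType) (x y z w v : 'rV[K]_4) :
  row_free (rows4 x y z w) ->
  exists c0 c1 c2 c3, v = comb4 x y z w c0 c1 c2 c3.
Proof.
rewrite row_free_unit => unit4; pose c := v *m invmx (rows4 x y z w).
exists (c 0 (inord 0)), (c 0 (inord 1)), (c 0 (inord 2)), (c 0 (inord 3)).
by rewrite -mul_rows4 mulmxKV.
Qed.

Lemma rows4_adds (K : fieldType) (x y z w : 'rV[K]_4) :
  (rows4 x y z w :=: x + y + z + w)%MS.
Proof.
apply/eqmxP/andP; split.
  apply/row_subP => -[[|[|[|[|i]]]] lti] //; rewrite rowK /=.
  - by rewrite -!addsmxA addsmxSl.
  - by rewrite -addsmxA (submx_trans _ (addsmxSl _ _)) ?addsmxSr.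
  - by rewrite (submx_trans _ (addsmxSl _ _)) ?addsmxSr.
  - exact: addsmxSr.
have rowE (i : nat) : (i < 4)%N ->
    (nth 0 [:: x; y; z; w] i <= rows4 x y z w)%MS.
  by move=> lti; have := row_sub (Ordinal lti) (rows4 x y z w); rewrite rowK.
by rewrite !addsmx_sub (rowE 0) ?(rowE 1) ?(rowE 2) ?(rowE 3).
Qed.

Lemma free4_rank (K : fieldType) (x y z w : 'rV[K]_4) :
  row_free (rows4 x y z w) = (\rank (x + y + z + w)%MS == 4).
Proof. by rewrite -(rows4_adds x y z w). Qed.

Lemma addsmxAC (K : fieldType) m1 m2 m3 n (A : 'M[K]_(m1, n))
    (B : 'M[K]_(m2, n)) (C : 'M[K]_(m3, n)) :
  (A + B + C = A + C + B)%MS.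
Proof. by rewrite -!addsmxA (addsmxC B). Qed.

Lemma free4_swap (K : fieldType) (x y z w : 'rV[K]_4) :
  row_free (rows4 x y z w) = row_free (rows4 x z y w).
Proof. by rewrite !free4_rank (addsmxAC x). Qed.

Lemma free4_flip (K : fieldType) (x y z w : 'rV[K]_4) :
  row_free (rows4 x y z w) = row_free (rows4 x y w z).
Proof. by rewrite !free4_rank (addsmxAC (x + y)%MS). Qed.

Lemma free4_rot (K : fieldType) (x y z w : 'rV[K]_4) :
  row_free (rows4 x y z w) = row_free (rows4 y z w x).
Proof. by rewrite !free4_rank (addsmxC _ x) !addsmxA. Qed.

(** Three independent points of a plane span it, so that any further point of
    the plane, such as the fourth neighbour in a star, is a combination of
    them. *)
Lemma coplanar_span (K : fieldType) m (U : 'M[K]_(m, 4)) (x y z w v : 'rV[K]_4) :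
    row_free (rows4 x y z w) -> (\rank U <= 3)%N ->
    (x <= U)%MS -> (y <= U)%MS -> (z <= U)%MS -> (v <= U)%MS ->
  (v <= x + y + z)%MS.
Proof.
rewrite free4_rank => /eqP rank4 rankU Ux Uy Uz /submx_trans; apply.
have sub : (x + y + z <= U)%MS by rewrite !addsmx_sub Ux Uy.
rewrite -(mxrank_leqif_sup sub).2 eqn_leq (mxrankS sub).
apply: leq_trans rankU _; rewrite -(leq_add2r 1).
have := (mxrank_adds_leqif (x + y + z)%MS w).1; rewrite rank4 => /leq_trans; apply.
by rewrite leq_add2l rank_leq_row.
Qed.

Lemma adds3P (K : fieldType) (x y z v : 'rV[K]_4) :
  (v <= x + y + z)%MS -> exists c0 c1 c2, v = c0 *: x + c1 *: y + c2 *: z.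
Proof.
case/sub_addsmxP=> [[c d]] /= ->.
have /sub_addsmxP[[c' d'] /= ->] := submxMl c (x + y)%MS.
exists (c' 0 0), (d' 0 0), (d 0 0).
by rewrite -!mul_scalar_mx -!mx11_scalar.
Qed.

Lemma adds2P (K : fieldType) (x y v : 'rV[K]_4) :
  (v <= x + y)%MS -> exists p q, v = p *: x + q *: y.
Proof.
case/sub_addsmxP=> [[c d]] /= ->; exists (c 0 0), (d 0 0).
by rewrite -!mul_scalar_mx -!mx11_scalar.
Qed.

Lemma comb4_swap (K : fieldType) (x y z w : 'rV[K]_4) c0 c1 c2 c3 :
  comb4 x z y w c0 c2 c1 c3 = comb4 x y z w c0 c1 c2 c3.
Proof. by rewrite /comb4 [c0 *: x + _ + _]addrAC. Qed.

Lemma comb4_map (R K : fieldType) (phi : {rmorphism R -> K}) (x y z w : 'rV[R]_4)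
    c0 c1 c2 c3 :
  map_mx phi (comb4 x y z w c0 c1 c2 c3) =
  comb4 (map_mx phi x) (map_mx phi y) (map_mx phi z) (map_mx phi w)
        (phi c0) (phi c1) (phi c2) (phi c3).
Proof. by rewrite /comb4 !map_mxD !map_mxZ. Qed.

Lemma comb4_unit1 (K : fieldType) (x y z w : 'rV[K]_4) c :
  c != 0 -> y = comb4 x (c *: y) z w 0 (1 / c) 0 0.
Proof.
by move=> c0; rewrite /comb4 !scale0r scalerA div1r mulVf // scale1r add0r !addr0.
Qed.

Lemma comb4_unit3 (K : fieldType) (x y z w : 'rV[K]_4) c e :
  (e / c) *: w = comb4 x y z (e *: w) 0 0 0 (1 / c).
Proof. by rewrite /comb4 !scale0r scalerA !add0r div1r mulrC. Qed.

Lemma free4_map (R K : fieldType) (phi : {rmorphism R -> K}) (x y z w : 'rV[R]_4) :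
  row_free (rows4 (map_mx phi x) (map_mx phi y) (map_mx phi z) (map_mx phi w)) =
  row_free (rows4 x y z w).
Proof.
rewrite -(row_free_map phi); congr row_free.
by apply/row_matrixP=> -[[|[|[|[|i]]]] lti] //; rewrite -map_row !rowK.
Qed.

Lemma free4_scale (K : fieldType) (x y z w : 'rV[K]_4) c0 c1 c2 c3 :
    c0 != 0 -> c1 != 0 -> c2 != 0 -> c3 != 0 ->
  row_free (rows4 (c0 *: x) (c1 *: y) (c2 *: z) (c3 *: w)) =
  row_free (rows4 x y z w).
Proof.
move=> c00 c10 c20 c30; rewrite !free4_rank.
by rewrite (adds_eqmx (adds_eqmx (adds_eqmx (eqmx_scale x c00) (eqmx_scale y c10))
  (eqmx_scale z c20)) (eqmx_scale w c30)).
Qed.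

(** * The Gauss equations of a discrete asymptotic net *)

(** All notions of the theory are invariant under exchange of the two lattice
    directions; the equations of the second direction are those of the first
    one for the exchanged lattice. *)
Definition swap_axes (T : Type) (h : lattice T) : lattice T := fun n1 n2 => h n2 n1.

Lemma net_swap (K : fieldType) (s : lattice 'rV[K]_4) :
  discrete_asymptotic_net s -> discrete_asymptotic_net (swap_axes s).
Proof.
move=> net n1 n2; have [] := net n2 n1.
rewrite /coplanar_star /nonplanar_quadrilateral /swap_axes /sh12 /sh1 /sh2 /bk1 /bk2.
move=> cop free; split; last by rewrite free4_swap.
by rewrite (addsmxAC (s n2 n1)) addsmxAC.
Qed.

(** The two zeros express the planarity of the stars at s_1 and at s_12. *)
Definition gauss_equations (K : fieldType) (s : lattice 'rV[K]_4)
    (a x y b g h : lattice K) : Prop :=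
  forall n1 n2,
    let quad := comb4 (s n1 n2) (s (n1 + 1) n2) (s n1 (n2 + 1))
                      (s (n1 + 1) (n2 + 1)) in
    [/\ s (n1 + 1 + 1) n2 = quad (a n1 n2) (x n1 n2) 0 (y n1 n2),
        s (n1 + 1 + 1) (n2 + 1) = quad 0 (g n1 n2) (b n1 n2) (h n1 n2),
        a n1 n2 != 0 & b n1 n2 != 0].

(** The vectors s, s_1, s_12 span the plane of the star at s_1, and s_1, s_2,
    s_12 that of the star at s_12; these planes contain s_11 and s_112.  If the
    coefficient a, or b, vanished, the next quadrilateral s_1, s_11, s_12, s_112
    would be planar. *)
Lemma gauss_equations_net (K : fieldType) (s : lattice 'rV[K]_4) :
    discrete_asymptotic_net s ->
  exists a x y b g h, gauss_equations s a x y b g h.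
Proof.
move=> net.
pose quad n1 n2 := rows4 (s n1 n2) (s (n1 + 1) n2) (s n1 (n2 + 1))
                         (s (n1 + 1) (n2 + 1)).
have free n1 n2 : row_free (quad n1 n2) by case: (net n1 n2).
pose c n1 n2 := s (n1 + 1 + 1) n2 *m invmx (quad n1 n2).
pose d n1 n2 := s (n1 + 1 + 1) (n2 + 1) *m invmx (quad n1 n2).
pose coef (e : int -> int -> 'rV[K]_4) i n1 n2 := e n1 n2 0 (inord i).
exists (coef c 0), (coef c 1), (coef c 3), (coef d 2), (coef d 1), (coef d 3).
move=> n1 n2 Q.
have unitQ : quad n1 n2 \in unitmx by rewrite -row_free_unit.
have cE : s (n1 + 1 + 1) n2 = Q (coef c 0 n1 n2) (coef c 1 n1 n2)
    (coef c 2 n1 n2) (coef c 3 n1 n2).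
  by rewrite /Q -mul_rows4 mulmxKV.
have dE : s (n1 + 1 + 1) (n2 + 1) = Q (coef d 0 n1 n2) (coef d 1 n1 n2)
    (coef d 2 n1 n2) (coef d 3 n1 n2).
  by rewrite /Q -mul_rows4 mulmxKV.
have subl (A B C D E : 'rV[K]_4) : [/\ A <= A + B + C + D + E,
    B <= A + B + C + D + E, C <= A + B + C + D + E, D <= A + B + C + D + E
    & E <= A + B + C + D + E]%MS.
  have := submx_refl (A + B + C + D + E)%MS.
  by rewrite !addsmx_sub -!andbA => /and5P[-> -> -> -> ->].
have c2 : coef c 2 n1 n2 = 0.
  have [cop _] := net (n1 + 1) n2.
  rewrite /coplanar_star /sh1 /sh2 /bk1 /bk2 addrK in cop.
  have := free n1 n2; rewrite /quad free4_flip => /coplanar_span/(_ cop).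
  have [-> Ev -> -> _] := subl (s (n1 + 1) n2) (s (n1 + 1 + 1) n2)
    (s (n1 + 1) (n2 + 1)) (s n1 n2) (s (n1 + 1) (n2 - 1)).
  move=> /(_ _ isT isT isT Ev)/adds3P[p [q [t eqv]]].
  have : Q p q 0 t = s (n1 + 1 + 1) n2 by rewrite /Q /comb4 scale0r addr0 eqv.
  by rewrite cE => /(comb4_inj (free n1 n2))[].
have d0 : coef d 0 n1 n2 = 0.
  have [cop _] := net (n1 + 1) (n2 + 1).
  rewrite /coplanar_star /sh1 /sh2 /bk1 /bk2 !addrK in cop.
  have := free n1 n2; rewrite /quad free4_rot => /coplanar_span/(_ cop).
  have [-> Ev _ -> ->] := subl (s (n1 + 1) (n2 + 1)) (s (n1 + 1 + 1) (n2 + 1))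
    (s (n1 + 1) (n2 + 1 + 1)) (s n1 (n2 + 1)) (s (n1 + 1) n2).
  move=> /(_ _ isT isT isT Ev)/adds3P[p [q [t eqv]]].
  have : Q 0 p q t = s (n1 + 1 + 1) (n2 + 1) by rewrite /Q /comb4 scale0r add0r eqv.
  by rewrite dE => /(comb4_inj (free n1 n2))[].
rewrite c2 in cE; rewrite d0 in dE; split=> //.
  (* a = 0 would make s_11 a combination of s_1 and s_12. *)
  apply/eqP=> c0; have := free (n1 + 1) n2.
  move=> /(@comb4_inj _ _ _ _ _ (coef c 1 n1 n2) (-1) (coef c 3 n1 n2) 0 0 0 0 0).
  rewrite [in X in X -> _]cE c0 /Q /comb4 !scale0r scaleN1r !addr0 add0r.
  rewrite addrAC subrr => /(_ erefl)[_ /eqP].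
  by rewrite oppr_eq0 oner_eq0.
apply/eqP=> c0; have := free (n1 + 1) n2.
move=> /(@comb4_inj _ _ _ _ _ (coef d 1 n1 n2) 0 (coef d 3 n1 n2) (-1) 0 0 0 0).
rewrite [in X in X -> _]dE c0 /Q /comb4 !scale0r scaleN1r !addr0 add0r.
by rewrite subrr => /(_ erefl)[_ _ _ /eqP]; rewrite oppr_eq0 oner_eq0.
Qed.

(** The vector s_112 is obtained from the basis at (n1, n2) directly, or by
    shifting the equation for s_11 in direction 2 and substituting s_122; the
    latter is treated likewise.  The comparison gives
      b = a_2 + y_2 g',  g = y_2 b',  b' = a'_1 + y'_1 g,  g' = y'_1 b,
    so that a_2 = b (1 - y_2 y'_1) and a'_1 = b' (1 - y_2 y'_1), whence the first
    identity.  The second one compares the coefficients of s in the two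
    expressions of s_1122: only s_22 and s_11, respectively, contribute. *)
Lemma gauss_compatibility (K : fieldType) (s : lattice 'rV[K]_4)
    (a x y b g h a' x' y' b' g' h' : lattice K) :
    discrete_asymptotic_net s ->
    gauss_equations s a x y b g h ->
    gauss_equations (swap_axes s) (swap_axes a') x' y' (swap_axes b') g' h' ->
  forall n1 n2,
    a n1 (n2 + 1) * b' n1 n2 = a' (n1 + 1) n2 * b n1 n2 /\
    b n1 (n2 + 1) * a' n1 n2 = b' (n1 + 1) n2 * a n1 n2.
Proof.
rewrite /gauss_equations /swap_axes => net E1 E2 n1 n2.
have [_ free] := net n1 n2.
have [e11 e112 _ _] := E1 n1 n2; have [e22 e122 _ _] := E2 n2 n1.
have [f112 f1122 _ _] := E1 n1 (n2 + 1); have [f122 f1122' _ _] := E2 n2 (n1 + 1).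
have inj := comb4_inj free; rewrite /sh1 /sh2 /sh12 /comb4 in inj.
rewrite /comb4 in e11 e112 e22 e122 f112 f1122 f122 f1122'.
split.
  have [_ gE bE _] : [/\ 0 = 0 :> K, g n1 n2 = y n1 (n2 + 1) * b' n1 n2,
      b n1 n2 = a n1 (n2 + 1) + y n1 (n2 + 1) * g' n2 n1
      & h n1 n2 = x n1 (n2 + 1) + y n1 (n2 + 1) * h' n2 n1].
    apply: inj; rewrite -e112 f112 e122; apply/rowP=> i; rewrite !mxE; ring.
  have [_ b'E g'E _] : [/\ 0 = 0 :> K,
      b' n1 n2 = a' (n1 + 1) n2 + y' n2 (n1 + 1) * g n1 n2,
      g' n2 n1 = y' n2 (n1 + 1) * b n1 n2
      & h' n2 n1 = x' n2 (n1 + 1) + y' n2 (n1 + 1) * h n1 n2].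
    apply: inj; transitivity (s (n1 + 1) (n2 + 1 + 1)).
      by rewrite e122; apply/rowP=> i; rewrite !mxE; ring.
    rewrite f122 e112; apply/rowP=> i; rewrite !mxE; ring.
  have -> : a n1 (n2 + 1) = b n1 n2 - y n1 (n2 + 1) * g' n2 n1 by rewrite bE addrK.
  have -> : a' (n1 + 1) n2 = b' n1 n2 - y' n2 (n1 + 1) * g n1 n2 by rewrite b'E addrK.
  by rewrite g'E gE; ring.
suff [//] : [/\ b n1 (n2 + 1) * a' n1 n2 = b' (n1 + 1) n2 * a n1 n2,
  g n1 (n2 + 1) * 0 + h n1 (n2 + 1) * b' n1 n2 =
    b' (n1 + 1) n2 * x n1 n2 + h' n2 (n1 + 1) * g n1 n2,
  b n1 (n2 + 1) * x' n2 n1 + h n1 (n2 + 1) * g' n2 n1 =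
    h' n2 (n1 + 1) * b n1 n2
  & g n1 (n2 + 1) + b n1 (n2 + 1) * y' n2 n1 + h n1 (n2 + 1) * h' n2 n1 =
    g' n2 (n1 + 1) + b' (n1 + 1) n2 * y n1 n2 + h' n2 (n1 + 1) * h n1 n2].
apply: inj; transitivity (s (n1 + 1 + 1) (n2 + 1 + 1)).
  rewrite f1122 e22 e122; apply/rowP=> i; rewrite !mxE; ring.
rewrite f1122' e11 e112; apply/rowP=> i; rewrite !mxE; ring.
Qed.

(** The numbers p and q of the non-separation condition at the vertex s_12 are
    uniquely determined: p = a_2 and q = b. *)
Lemma nonseparating_gt0 (R : realFieldType) (s : lattice 'rV[R]_4)
    (a x y b g h : lattice R) :
    discrete_asymptotic_net s -> nonseparating_stars s ->
    gauss_equations s a x y b g h ->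
  forall n1 n2, 0 < b n1 n2 / a n1 (n2 + 1).
Proof.
move=> net nonsep E n1 n2.
have [p [q []]] := nonsep (n1 + 1) (n2 + 1).
rewrite /sh1 /sh2 /bk1 /bk2 !addrK => pq_gt0.
move=> /sub_addsmxP[[t t'] /=]; rewrite [t]mx11_scalar [t']mx11_scalar.
rewrite !mul_scalar_mx => /eqP; rewrite subr_eq => /eqP eqp.
move=> /sub_addsmxP[[u u'] /=]; rewrite [u]mx11_scalar [u']mx11_scalar.
rewrite !mul_scalar_mx => /eqP; rewrite subr_eq => /eqP eqq.
have [_ e112 _ b0] := E n1 n2; have [f112 _ a0 _] := E n1 (n2 + 1).
have [_ free] := net n1 n2; have [_ free2] := net n1 (n2 + 1).
have [pE _ _ _] : [/\ p = a n1 (n2 + 1), t 0 0 = x n1 (n2 + 1), 0 = 0 :> R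
    & t' 0 0 = y n1 (n2 + 1)].
  apply: (comb4_inj free2); rewrite -f112 eqp /comb4.
  by apply/rowP=> i; rewrite !mxE; ring.
have [_ _ qE _] : [/\ 0 = 0 :> R, u' 0 0 = g n1 n2, q = b n1 n2
    & u 0 0 = h n1 n2].
  apply: (comb4_inj free); rewrite -e112 eqq /comb4.
  by apply/rowP=> i; rewrite !mxE; ring.
rewrite -(pmulr_lgt0 _ (_ : 0 < a n1 (n2 + 1) ^+ 2)) ?exprn_even_gt0 //.
rewrite expr2 mulrA divfK //.
by rewrite mulrC -pE -qE.
Qed.

(** * Quadrics through the edges of a quadrilateral *)

(** The bilinear form of a quadric, whose quadratic form gives incidence and
    whose polarity gives tangent planes. *)
Definition form (K : fieldType) (S : 'M[K]_4) (x y : 'rV[K]_4) : K :=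
  (x *m S *m y^T) 0 0.

Lemma formDl (K : fieldType) (S : 'M[K]_4) x y z :
  form S (x + y) z = form S x z + form S y z.
Proof. by rewrite /form !mulmxDl mxE. Qed.

Lemma formZl (K : fieldType) (S : 'M[K]_4) c x z :
  form S (c *: x) z = c * form S x z.
Proof. by rewrite /form -!scalemxAl mxE. Qed.

Lemma formDr (K : fieldType) (S : 'M[K]_4) x y z :
  form S x (y + z) = form S x y + form S x z.
Proof. by rewrite /form linearD mulmxDr mxE. Qed.

Lemma formZr (K : fieldType) (S : 'M[K]_4) c x z :
  form S x (c *: z) = c * form S x z.
Proof. by rewrite /form linearZ -scalemxAr mxE. Qed.

Lemma formC (K : fieldType) (S : 'M[K]_4) x y :
  S^T = S -> form S x y = form S y x.
Proof.
move=> symS; rewrite /form [in RHS](_ : y *m S *m x^T = (x *m S *m y^T)^T) ?mxE //.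
by rewrite !trmx_mul trmxK symS mulmxA.
Qed.

Lemma mx11_eq0 (K : fieldType) (A : 'M[K]_1) : A = 0 <-> A 0 0 = 0.
Proof. by split=> [->|A0]; rewrite ?mxE // [A]mx11_scalar A0 raddf0. Qed.

Lemma on_quadricE (K : fieldType) (S : 'M[K]_4) x :
  on_quadric S x <-> form S x x = 0.
Proof. exact: mx11_eq0. Qed.

Lemma tangentE (K : fieldType) (S : 'M[K]_4) x y :
  in_tangent_plane S x y <-> form S x y = 0.
Proof. exact: mx11_eq0. Qed.

Lemma form_map (R K : fieldType) (phi : {rmorphism R -> K}) (S : 'M[R]_4) x y :
  form (map_mx phi S) (map_mx phi x) (map_mx phi y) = phi (form S x y).
Proof. by rewrite /form map_trmx -!map_mxM mxE. Qed.

(** The Gram matrix of a quadric passing through the four edges of the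
    quadrilateral x, y, z, t, where x t and y z are the diagonals; the remaining
    freedom is the ratio w : w', the parameter of the pencil. *)
Record edge_quadric (K : fieldType) (S : 'M[K]_4) (x y z t : 'rV[K]_4)
    (w w' : K) : Prop := EdgeQuadric {
  edge_sym : S^T = S;
  edge_xx : form S x x = 0; edge_yy : form S y y = 0;
  edge_zz : form S z z = 0; edge_tt : form S t t = 0;
  edge_xy : form S x y = 0; edge_xz : form S x z = 0;
  edge_yt : form S y t = 0; edge_zt : form S z t = 0;
  edge_xt : form S x t = w; edge_yz : form S y z = w' }.

Lemma edge_quadric_swap (K : fieldType) (S : 'M[K]_4) x y z t w w' :
  edge_quadric S x y z t w w' -> edge_quadric S x z y t w w'.
Proof.
case=> symS xx yy zz tt xy xz yt zt xt yz; apply: EdgeQuadric => //.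
by rewrite formC.
Qed.

Lemma edge_quadric_map (R K : fieldType) (phi : {rmorphism R -> K})
    (S : 'M[R]_4) x y z t w w' :
  edge_quadric S x y z t w w' ->
  edge_quadric (map_mx phi S) (map_mx phi x) (map_mx phi y) (map_mx phi z)
    (map_mx phi t) (phi w) (phi w').
Proof.
case=> symS xx yy zz tt xy xz yt zt <- <-.
by apply: EdgeQuadric; rewrite ?map_trmx ?symS ?form_map
  ?(xx, yy, zz, tt, xy, xz, yt, zt) ?rmorph0.
Qed.

Lemma edge_quadric_scale (K : fieldType) (S : 'M[K]_4) x y z t w w' cx cy cz ct :
  edge_quadric S x y z t w w' ->
  edge_quadric S (cx *: x) (cy *: y) (cz *: z) (ct *: t)
    (cx * ct * w) (cy * cz * w').
Proof.
case=> symS xx yy zz tt xy xz yt zt <- <-.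
by apply: EdgeQuadric; rewrite // ?formZl ?formZr ?(xx, yy, zz, tt, xy, xz, yt, zt) ?mulr0 ?mulrA.
Qed.

Definition edge_quadric_mx (K : fieldType) (x y z t : 'rV[K]_4) (w w' : K) : 'M[K]_4 :=
  invmx (rows4 x y z t)
  *m mx4 [:: [:: 0; 0; 0; w]; [:: 0; 0; w'; 0]; [:: 0; w'; 0; 0]; [:: w; 0; 0; 0]]
  *m (invmx (rows4 x y z t))^T.

Lemma edge_quadric_mxP (K : fieldType) (x y z t : 'rV[K]_4) (w w' : K) :
  row_free (rows4 x y z t) ->
  edge_quadric (edge_quadric_mx x y z t w w') x y z t w w'.
Proof.
rewrite row_free_unit /edge_quadric_mx; set N := rows4 x y z t => unitN.
set J := mx4 _; set S := _ *m _.
have symJ : J^T = J.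
  by apply/matrixP=> -[[|[|[|[|i]]]] lti] // -[[|[|[|[|j]]]] ltj] //; rewrite !mxE.
have formE (i j : 'I_4) : form S (row i N) (row j N) = J i j.
  rewrite /form -row_mul tr_row -row_mul colE mulmxA -colE.
  suff -> : N *m S *m N^T = J by rewrite !mxE.
  rewrite /S !mulmxA mulmxV // mul1mx -mulmxA -trmx_mul mulmxV // trmx1 mulmx1 //.
have rE (i : 'I_4) : row i N = nth 0 [:: x; y; z; t] i by rewrite rowK.
have symS : S^T = S by rewrite /S !trmx_mul trmxK symJ !mulmxA.
pose o (i : nat) (lti : (i < 4)%N) := Ordinal lti.
by apply: EdgeQuadric => //;
 [ have := formE (@o 0 isT) (@o 0 isT) | have := formE (@o 1 isT) (@o 1 isT)
 | have := formE (@o 2 isT) (@o 2 isT) | have := formE (@o 3 isT) (@o 3 isT)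
 | have := formE (@o 0 isT) (@o 1 isT) | have := formE (@o 0 isT) (@o 2 isT)
 | have := formE (@o 1 isT) (@o 3 isT) | have := formE (@o 2 isT) (@o 3 isT)
 | have := formE (@o 0 isT) (@o 3 isT) | have := formE (@o 1 isT) (@o 2 isT)];
 rewrite !rE mxE.
Qed.

Lemma form_comb4 (K : fieldType) (S : 'M[K]_4) x y z t w w' c0 c1 c2 c3 d0 d1 d2 d3 :
  edge_quadric S x y z t w w' ->
  form S (comb4 x y z t c0 c1 c2 c3) (comb4 x y z t d0 d1 d2 d3) =
    w * (c0 * d3 + c3 * d0) + w' * (c1 * d2 + c2 * d1).
Proof.
case=> symS xx yy zz tt xy xz yt zt xt yz.
rewrite /comb4 !formDl !formDr !formZl !formZr.
rewrite (formC y x symS) (formC z x symS) (formC t x symS) (formC z y symS)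
  (formC t y symS) (formC t z symS).
by rewrite xx yy zz tt xy xz yt zt xt yz; ring.
Qed.

(** With w' = - w the quadric has the equation c0 c3 = c1 c2 in the coordinates
    of the four points.  This is the Segre embedding: a 2 x 2 matrix of
    determinant 0 is a product of a column and a row. *)
Lemma edge_quadric_parametrised (K : fieldType) (S : 'M[K]_4) x y z t w :
    (2 : K) != 0 -> row_free (rows4 x y z t) -> w != 0 ->
    edge_quadric S x y z t w (- w) ->
  parametrised_quadric x y z t S.
Proof.
move=> two0 free w0 quadS v _; rewrite on_quadricE; split=> [|[m0 [m1 [n0 [n1 ->]]]]].
  have [c0 [c1 [c2 [c3 ->]]]] := comb4_span v free.
  rewrite (form_comb4 _ _ _ _ _ _ _ _ quadS) => on_v.
  have : c0 * c3 == c1 * c2.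
    rewrite -subr_eq0 -(mulrI_eq0 _ (mulfI (_ : 2 * w != 0))) ?mulf_neq0 //.
    by rewrite -on_v; apply/eqP; ring.
  (* If c3 = 0, then m1 or n1 has to vanish, according to which of c1 and c2
     does; otherwise n1 = 1 normalises. *)
  have [->|c30] := eqVneq c3 0.
    rewrite mulr0 eq_sym mulf_eq0 => /orP[]/eqP->.
      exists c0, c2, 1, 0.
      by rewrite /comb4; apply/rowP=> i; rewrite !mxE; ring.
    exists 1, 0, c0, c1.
    by rewrite /comb4; apply/rowP=> i; rewrite !mxE; ring.
  move=> /eqP segre; exists c1, c3, (c2 / c3), 1.
  have -> : c0 = c1 * c2 / c3 by rewrite -segre mulfK.
  by rewrite /comb4; apply/rowP=> i; rewrite !mxE; field.
have -> : (m1 * n1) *: t + (m0 * n1) *: y + (m1 * n0) *: z + (m0 * n0) *: x =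
    comb4 x y z t (m0 * n0) (m0 * n1) (m1 * n0) (m1 * n1).
  by apply/rowP=> i; rewrite !mxE; ring.
by rewrite (form_comb4 _ _ _ _ _ _ _ _ quadS); ring.
Qed.

Lemma edge_quadric_associated (K : fieldType) (s : lattice 'rV[K]_4) n1 n2
    (S : 'M[K]_4) w w' :
    edge_quadric S (s n1 n2) (s (n1 + 1) n2) (s n1 (n2 + 1)) (s (n1 + 1) (n2 + 1))
      w w' -> w != 0 ->
  associated_quadric s n1 n2 S.
Proof.
move=> quadS w0; have [symS xx yy zz tt xy xz yt zt xt yz] := quadS.
have line u v : form S u u = 0 -> form S v v = 0 -> form S u v = 0 ->
    passes_through_line S u v.
  move=> uu vv uv r /adds2P[p [q ->]]; apply/on_quadricE.
  rewrite !formDl !formDr !formZl !formZr (formC v u symS) uu vv uv.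
  by rewrite !mulr0 !addr0.
split; last by split; apply: line.
split=> //; apply: contra_neq w0 => S0.
by rewrite -xt S0 /form mulmx0 mul0mx mxE.
Qed.

(** For x on the common edge r1, r12 the polar forms of the two quadrics are
    compared on the basis r1, r11, r12, r112.  The form of the first quadric
    pairs r1 with r2 and r12 with r, and r and r2 enter this basis only through
    the components a of r11 and b of r112; so the two forms are proportional,
    with factor - k b, exactly when k k' b = a. *)
Lemma edge_quadric_C1 (K : fieldType) (S S' : 'M[K]_4)
    (r r1 r2 r12 r11 r112 : 'rV[K]_4) (a x y b g h k k' : K) :
    row_free (rows4 r1 r11 r12 r112) ->
    r11 = comb4 r r1 r2 r12 a x 0 y -> r112 = comb4 r r1 r2 r12 0 g b h ->
    b != 0 -> k != 0 -> k' != 0 -> k * k' * b = a ->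
    edge_quadric S r r1 r2 r12 1 (- k) ->
    edge_quadric S' r1 r11 r12 r112 1 (- k') ->
  C1_along S S' r1 r12.
Proof.
move=> free e11 e112 b0 k0 k'0 kk' quadS quadS' v v0 /adds2P[p [q vE]].
rewrite {v}vE in v0 *.
have vr : p *: r1 + q *: r12 = comb4 r r1 r2 r12 0 p 0 q.
  by apply/rowP=> i; rewrite !mxE; ring.
have vr1 : p *: r1 + q *: r12 = comb4 r1 r11 r12 r112 p 0 q 0.
  by apply/rowP=> i; rewrite !mxE; ring.
have formE u : form S (p *: r1 + q *: r12) u = - (k * b) * form S' (p *: r1 + q *: r12) u.
  have [d0 [d1 [d2 [d3 uE]]]] := comb4_span u free.
  have uE' : u = comb4 r r1 r2 r12 (d1 * a) (d0 + d1 * x + d3 * g) (d3 * b)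
      (d1 * y + d2 + d3 * h).
    by rewrite uE e11 e112; apply/rowP=> i; rewrite !mxE; ring.
  rewrite {1}uE' vr (form_comb4 _ _ _ _ _ _ _ _ quadS).
  rewrite -vr vr1 uE (form_comb4 _ _ _ _ _ _ _ _ quadS').
  by rewrite -kk'; ring.
have kb0 : - (k * b) != 0 by rewrite oppr_eq0 mulf_neq0.
have S'0 : (p *: r1 + q *: r12) *m S' != 0.
  apply: contra_neq v0 => S'0.
  have z u : form S' (p *: r1 + q *: r12) u = 0 by rewrite /form S'0 mul0mx mxE.
  have := z (comb4 r1 r11 r12 r112 0 0 0 1); rewrite vr1 (form_comb4 _ _ _ _ _ _ _ _ quadS').
  rewrite !(mul0r, mulr0, addr0, mulr1, mul1r) => ->.
  have := z (comb4 r1 r11 r12 r112 0 1 0 0); rewrite vr1 (form_comb4 _ _ _ _ _ _ _ _ quadS').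
  rewrite !(mul0r, mulr0, addr0, add0r, mulr1) => /eqP.
  rewrite mulf_eq0 oppr_eq0 (negPf k'0) /= => /eqP->.
  by rewrite /comb4 !scale0r !addr0.
split=> //.
  apply: contra_neq S'0 => S0; apply/row_matrixP=> i.
  apply/rowP=> j; have := formE (delta_mx 0 j); rewrite {1}/form S0 mul0mx mxE.
  move/esym/eqP; rewrite mulf_eq0 (negPf kb0) /form trmx_delta -colE mxE => /eqP.
  by rewrite !mxE (ord1 i).
move=> u; rewrite !tangentE formE; split=> [/eqP|->]; last by rewrite mulr0.
by rewrite mulf_eq0 (negPf kb0) => /eqP.
Qed.

(** * The lattice of Lie quadrics *)

(** The two systems for k are compatible by both identities of
    gauss_compatibility. *)
Lemma Lie_quadrics_exist (K : fieldType) (s : lattice 'rV[K]_4)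
    (a x y b g h a' x' y' b' g' h' : lattice K) :
    discrete_asymptotic_net s ->
    gauss_equations s a x y b g h ->
    gauss_equations (swap_axes s) (swap_axes a') x' y' (swap_axes b') g' h' ->
  exists k : lattice K, forall n1 n2, [/\ k n1 n2 != 0,
    k n1 n2 * k (n1 + 1) n2 * b n1 n2 = a n1 n2
    & k n1 n2 * k n1 (n2 + 1) * b' n1 n2 = a' n1 n2].
Proof.
move=> net E E'.
have ab0 n1 n2 : a n1 n2 != 0 /\ b n1 n2 != 0 by case: (E n1 n2).
have ab0' n1 n2 : a' n1 n2 != 0 /\ b' n1 n2 != 0 by case: (E' n2 n1).
have [|||k kP] := @alternating_potential K (fun n1 n2 => a n1 n2 / b n1 n2)
  (fun n1 n2 => a' n1 n2 / b' n1 n2).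
- by move=> n1 n2; have [? ?] := ab0 n1 n2; rewrite mulf_neq0 ?invr_eq0.
- by move=> n1 n2; have [? ?] := ab0' n1 n2; rewrite mulf_neq0 ?invr_eq0.
- move=> n1 n2; have [c1 c2] := gauss_compatibility net E E' n1 n2.
  rewrite !mulf_div; apply/eqP; rewrite eqr_div ?mulf_neq0 //.
  + apply/eqP; transitivity (a' (n1 + 1) n2 * b n1 n2 * (b n1 (n2 + 1) * a' n1 n2)).
      by ring.
    by rewrite -c1 c2; ring.
  + by case: (ab0' (n1 + 1) n2).
  + by case: (ab0' n1 n2).
  + by case: (ab0 n1 (n2 + 1)).
  + by case: (ab0 n1 n2).
exists k => n1 n2; have [k0 -> ->] := kP n1 n2.
by rewrite !divfK ?k0 //; [case: (ab0' n1 n2)|case: (ab0 n1 n2)].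
Qed.

Lemma Lie_quadrics_lattice (K : fieldType) (s : lattice 'rV[K]_4)
    (a x y b g h a' x' y' b' g' h' k : lattice K) (Q : lattice 'M[K]_4) :
    discrete_asymptotic_net s ->
    gauss_equations s a x y b g h ->
    gauss_equations (swap_axes s) (swap_axes a') x' y' (swap_axes b') g' h' ->
    (forall n1 n2, [/\ k n1 n2 != 0,
      k n1 n2 * k (n1 + 1) n2 * b n1 n2 = a n1 n2
      & k n1 n2 * k n1 (n2 + 1) * b' n1 n2 = a' n1 n2]) ->
    (forall n1 n2, edge_quadric (Q n1 n2) (s n1 n2) (s (n1 + 1) n2)
      (s n1 (n2 + 1)) (s (n1 + 1) (n2 + 1)) 1 (- k n1 n2)) ->
  lattice_of_Lie_quadrics s Q.
Proof.
move=> net E E' kP quadQ n1 n2; have [k0 kk1 kk2] := kP n1 n2.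
split.
- by apply: edge_quadric_associated (quadQ n1 n2) _; apply: oner_neq0.
- have [e11 e112 _ b0] := E n1 n2; have [_ free] := net (n1 + 1) n2.
  have [k10 _ _] := kP (n1 + 1) n2.
  exact: (edge_quadric_C1 free e11 e112 b0 k0 k10 kk1 (quadQ n1 n2)
    (quadQ (n1 + 1) n2)).
have [e22 e122 _ b0] := E' n2 n1; have [_ free] := net_swap net (n2 + 1) n1.
have [k20 _ _] := kP n1 (n2 + 1).
exact: (edge_quadric_C1 free e22 e122 b0 k0 k20 kk2
  (edge_quadric_swap (quadQ n1 n2)) (edge_quadric_swap (quadQ n1 (n2 + 1)))).
Qed.

(** * The scalars of the frame *)

Lemma vertical_potential (K : fieldType) (Z : lattice K) :
  (forall n1 n2, Z n1 n2 != 0) ->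
  exists q : lattice K, forall n1 n2,
    q n1 n2 != 0 /\ q n1 (n2 + 1) = Z n1 n2 * q n1 n2.
Proof.
move=> Z0.
exists (fun n1 => orbit_from (fun n x => Z n1 n * x) (fun n x => (Z n1 n)^-1 * x) 1).
move=> n1 n2; split.
  apply: (@orbit_from_stable K (fun x => x != 0 : Prop)) => [n z z0|n z z0|];
  by rewrite ?oner_neq0 // mulf_neq0 ?invr_eq0.
apply: (@orbit_from_shift K (fun x => x != 0 : Prop)) => [n z z0|n z z0|n z z0|];
by rewrite ?oner_neq0 ?mulVKf // mulf_neq0 ?invr_eq0.
Qed.

(** The equations of alpha are alpha_2 = alpha / d and
    alpha_1 = - (lambda / (lambda_11 a)) alpha.  Their flatness follows by
    eliminating lambda_12 and lambda_112: it reduces to d^2 k k_1 a_2 = a, that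
    is, to the C1 equation for k. *)
Lemma frame_flatness (K : fieldType) (l l1 l2 l12 l11 l112 d d1 a a2 b k k1 : K) :
    l != 0 -> l1 != 0 -> l2 != 0 -> l11 != 0 -> d != 0 -> d1 != 0 ->
    a2 != 0 -> k != 0 -> k1 != 0 ->
    l * l12 = k * d * l1 * l2 -> l1 * l112 = k1 * d1 * l11 * l12 ->
    d ^+ 2 * a2 = b -> k * k1 * b = a ->
  d1^-1 * (l / (l11 * a)) = l2 / (l112 * a2) * d^-1.
Proof.
move=> l0 l10 l20 l110 d0 d10 a20 k0 k10 l12E l112E <- <-.
have -> : l112 = k1 * d1 * l11 * (k * d * l1 * l2 / l) / l1.
  by rewrite -l12E [l * l12]mulrC mulfK // -l112E mulrC mulKf.
by field; rewrite l0 l10 l20 l110 d0 d10 a20 k0 k10.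
Qed.

(** The equation for lambda is of second order.  It says that the quotient
    q = lambda_1 / lambda satisfies q_2 = k d q and that p = lambda_2 / lambda
    satisfies p_1 = k d p; any q and p solving these ordinary recurrences are the
    two quotients of a potential, because p_1 q = k d p q = q_2 p.  Once lambda
    is known, alpha and beta solve flat first-order systems. *)
Lemma frame_scalars (K : fieldType) (a b a' b' d k : lattice K) :
    (forall n1 n2, [/\ a n1 n2 != 0, b n1 n2 != 0, a' n1 n2 != 0,
      b' n1 n2 != 0 & d n1 n2 != 0]) ->
    (forall n1 n2, d n1 n2 ^+ 2 * a n1 (n2 + 1) = b n1 n2 /\
                   d n1 n2 ^+ 2 * a' (n1 + 1) n2 = b' n1 n2) ->
    (forall n1 n2, [/\ k n1 n2 != 0,
      k n1 n2 * k (n1 + 1) n2 * b n1 n2 = a n1 n2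
      & k n1 n2 * k n1 (n2 + 1) * b' n1 n2 = a' n1 n2]) ->
  exists lambda alpha beta : lattice K, forall n1 n2,
    [/\ [/\ lambda n1 n2 != 0, alpha n1 n2 != 0 & beta n1 n2 != 0],
        lambda n1 n2 * lambda (n1 + 1) (n2 + 1) =
          k n1 n2 * d n1 n2 * lambda (n1 + 1) n2 * lambda n1 (n2 + 1),
        d n1 n2 * alpha n1 (n2 + 1) = alpha n1 n2 /\
          d n1 n2 * beta (n1 + 1) n2 = beta n1 n2,
        alpha (n1 + 1) n2 * lambda (n1 + 1 + 1) n2 * a n1 n2 =
          - (alpha n1 n2 * lambda n1 n2)
      & beta n1 (n2 + 1) * lambda n1 (n2 + 1 + 1) * a' n1 n2 =
          - (beta n1 n2 * lambda n1 n2)].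
Proof.
move=> nz dP kP.
have kd0 n1 n2 : k n1 n2 * d n1 n2 != 0.
  by case: (nz n1 n2) (kP n1 n2) => _ _ _ _ d0 [k0 _ _]; rewrite mulf_neq0.
have [q qP] := vertical_potential kd0.
have [p pP] := @vertical_potential _ (swap_axes (fun n1 n2 => k n1 n2 * d n1 n2))
  (fun n1 n2 => kd0 n2 n1).
have [|||l lP] := @multiplicative_potential K q (swap_axes p).
- by move=> n1 n2; case: (qP n1 n2).
- by move=> n1 n2; case: (pP n2 n1).
- move=> n1 n2; rewrite /swap_axes; have [_ ->] := pP n2 n1; have [_ ->] := qP n1 n2.
  by rewrite /swap_axes mulrAC.
have l0 n1 n2 : l n1 n2 != 0 by case: (lP n1 n2).
have lE n1 n2 : l n1 n2 * l (n1 + 1) (n2 + 1) =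
    k n1 n2 * d n1 n2 * l (n1 + 1) n2 * l n1 (n2 + 1).
  have [_ -> _] := lP n1 (n2 + 1); have [_ -> _] := lP n1 n2.
  by have [_ ->] := qP n1 n2; ring.
have [|||al alP] := @multiplicative_potential K
  (fun n1 n2 => - (l n1 n2 / (l (n1 + 1 + 1) n2 * a n1 n2)))
  (fun n1 n2 => (d n1 n2)^-1).
- move=> n1 n2; have [a0 _ _ _ _] := nz n1 n2.
  by rewrite oppr_eq0 mulf_neq0 ?invr_eq0 ?mulf_neq0.
- by move=> n1 n2; have [_ _ _ _ d0] := nz n1 n2; rewrite invr_eq0.
- move=> n1 n2; rewrite mulrN mulNr; congr (- _).
  have [a0 _ _ _ d0] := nz n1 n2; have [_ _ _ _ d10] := nz (n1 + 1) n2.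
  have [a20 _ _ _ _] := nz n1 (n2 + 1); have [dd _] := dP n1 n2.
  have [k0 kk _] := kP n1 n2; have [k10 _ _] := kP (n1 + 1) n2.
  exact: (frame_flatness _ _ _ _ _ _ _ _ _ (lE n1 n2) (lE (n1 + 1) n2) dd kk).
have [|||be beP] := @multiplicative_potential K
  (fun n1 n2 => (d n1 n2)^-1)
  (fun n1 n2 => - (l n1 n2 / (l n1 (n2 + 1 + 1) * a' n1 n2))).
- by move=> n1 n2; have [_ _ _ _ d0] := nz n1 n2; rewrite invr_eq0.
- move=> n1 n2; have [_ _ a0 _ _] := nz n1 n2.
  by rewrite oppr_eq0 mulf_neq0 ?invr_eq0 ?mulf_neq0.
- move=> n1 n2; rewrite mulrN mulNr; congr (- _).
  have [_ _ a0 _ d0] := nz n1 n2; have [_ _ _ _ d20] := nz n1 (n2 + 1).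
  have [_ _ a10 _ _] := nz (n1 + 1) n2; have [_ dd] := dP n1 n2.
  have [k0 _ kk] := kP n1 n2; have [k20 _ _] := kP n1 (n2 + 1).
  have lE' m1 m2 : l m1 m2 * l (m1 + 1) (m2 + 1) =
      k m1 m2 * d m1 m2 * l m1 (m2 + 1) * l (m1 + 1) m2.
    by rewrite lE mulrAC.
  apply/esym.
  exact: (frame_flatness _ _ _ _ _ _ _ _ _ (lE' n1 n2) (lE' n1 (n2 + 1)) dd kk).
exists l, al, be => n1 n2.
have [a0 _ a'0 _ d0] := nz n1 n2.
have [al0 al1 al2] := alP n1 n2; have [be0 be1 be2] := beP n1 n2.
split=> //; [by rewrite al2 be1 !mulVKf | rewrite al1 | rewrite be2];
  field; rewrite ?a0 ?a'0 ?l0 //.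
Qed.

(** In the frame the Gauss equations acquire the coefficients a and b rescaled,
    which the choice of scalars normalises; the other entries of the connection
    matrices are unconstrained. *)
Lemma frame_derivatives (K : fieldType) (s s1 s2 s12 s11 s112 : 'rV[K]_4)
    (a x y b g h l l1 l2 l12 l11 l112 al al1 be ga ga1 : K) :
    s11 = comb4 s s1 s2 s12 a x 0 y -> s112 = comb4 s s1 s2 s12 0 g b h ->
    l1 != 0 -> l12 != 0 -> al != 0 -> ga != 0 ->
    al1 * l11 * a = - (al * l) -> ga1 * l112 * b = - (al * be * l2) ->
  let F := comb4 (l *: s) (al *: (l1 *: s1)) (be *: (l2 *: s2)) (ga *: (l12 *: s12)) in
  al1 *: (l11 *: s11) =
    F (- al) (al1 * l11 * x / (al * l1)) 0 (al1 * l11 * y / (ga * l12)) /\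
  ga1 *: (l112 *: s112) =
    F 0 (ga1 * l112 * g / (al * l1)) (- al) (ga1 * l112 * h / (ga * l12)).
Proof.
move=> -> -> l10 l120 al0 ga0 ea eb F; rewrite /F /comb4.
have den1 c : c / (al * l1) * (al * l1) = c by rewrite divfK ?mulf_neq0.
have den2 c : c / (ga * l12) * (ga * l12) = c by rewrite divfK ?mulf_neq0.
split; rewrite !scalerDr !scalerA !(mulr0, mul0r, scale0r, addr0, add0r).
  by rewrite -![_ / _ * _ * _]mulrA den1 den2 mulNr -ea.
rewrite -![_ / _ * _ * _]mulrA den1 den2 eb; congr (_ + _ *: _ + _).
by rewrite !mulNr ?mulrA.
Qed.

(** * The canonical frame *)

Lemma gauss_map (R K : fieldType) (phi : {rmorphism R -> K}) (s : lattice 'rV[R]_4)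
    (a x y b g h : lattice R) :
  gauss_equations s a x y b g h ->
  gauss_equations (fun n1 n2 => map_mx phi (s n1 n2))
    (fun n1 n2 => phi (a n1 n2)) (fun n1 n2 => phi (x n1 n2))
    (fun n1 n2 => phi (y n1 n2)) (fun n1 n2 => phi (b n1 n2))
    (fun n1 n2 => phi (g n1 n2)) (fun n1 n2 => phi (h n1 n2)).
Proof.
move=> E n1 n2; have [e11 e112 a0 b0] := E n1 n2.
by split; rewrite ?fmorph_eq0 // ?e11 ?e112 comb4_map rmorph0.
Qed.

(** With gamma = alpha beta / d this is the normalisation of the coefficient of
    s_2 in s_112.  It is not imposed on the scalars because it follows from the
    other equations and from the C1 equation for k. *)
Lemma gamma_step (K : fieldType) (l l1 l2 l12 l11 l112 d d1 a b k k1 al al1 be be1 : K) :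
    l != 0 -> l1 != 0 -> d1 != 0 ->
    l * l12 = k * d * l1 * l2 -> l1 * l112 = k1 * d1 * l11 * l12 ->
    k * k1 * b = a -> d * be1 = be -> al1 * l11 * a = - (al * l) ->
  al1 * be1 / d1 * l112 * b = - (al * be * l2).
Proof.
move=> l0 l10 d10 l12E l112E <- <- alE.
have -> : l112 = k1 * d1 * l11 * (k * d * l1 * l2 / l) / l1.
  by rewrite -l12E [l * l12]mulrC mulfK // -l112E mulrC mulKf.
have -> : al = - (al1 * l11 * (k * k1 * b)) / l by rewrite alE opprK mulfK.
by field; rewrite l0 l10 d10.
Qed.

(** The square roots d are the only reason to leave R: the Lie quadrics are
    constructed over R, and the rest of the frame is rational in the data. *)
Lemma canonical_frame_of_sqrt (R K : fieldType)
    (phi : {rmorphism R -> K}) (s : lattice 'rV[R]_4)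
    (a x y b g h : lattice R) (d : lattice K) :
    (2 : K) != 0 ->
    discrete_asymptotic_net s -> gauss_equations s a x y b g h ->
    (forall n1 n2, d n1 n2 ^+ 2 = phi (b n1 n2 / a n1 (n2 + 1))) ->
  admits_canonical_frame phi s.
Proof.
move=> two0 net E dP.
have [c [x' [y' [c' [g' [h' E']]]]]] := gauss_equations_net (net_swap net).
pose a' := swap_axes c; pose b' := swap_axes c'.
have {}E' : gauss_equations (swap_axes s) (swap_axes a') x' y' (swap_axes b') g' h' by [].
have [k kP] := Lie_quadrics_exist net E E'.
pose Q n1 n2 := edge_quadric_mx (s n1 n2) (s (n1 + 1) n2) (s n1 (n2 + 1))
  (s (n1 + 1) (n2 + 1)) 1 (- k n1 n2).
have free n1 n2 : row_free (rows4 (s n1 n2) (s (n1 + 1) n2) (s n1 (n2 + 1))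
    (s (n1 + 1) (n2 + 1))) by case: (net n1 n2).
have quadQ n1 n2 : edge_quadric (Q n1 n2) (s n1 n2) (s (n1 + 1) n2)
      (s n1 (n2 + 1)) (s (n1 + 1) (n2 + 1)) 1 (- k n1 n2).
  exact: edge_quadric_mxP (free n1 n2).
have ab0 n1 n2 : [/\ a n1 n2 != 0, b n1 n2 != 0, a' n1 n2 != 0 & b' n1 n2 != 0].
  by have [_ _ -> ->] := E n1 n2; have [_ _ ? ?] := E' n2 n1.
have d0 n1 n2 : d n1 n2 != 0.
  rewrite -sqrf_eq0 dP fmorph_eq0.
  by have [_ b0 _ _] := ab0 n1 n2; have [a0 _ _ _] := ab0 n1 (n2 + 1); rewrite mulf_neq0 ?invr_eq0.
have [||| l [al [be framP]]] := @frame_scalars K (fun n1 n2 => phi (a n1 n2))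
  (fun n1 n2 => phi (b n1 n2)) (fun n1 n2 => phi (a' n1 n2))
  (fun n1 n2 => phi (b' n1 n2)) d (fun n1 n2 => phi (k n1 n2)).
- by move=> n1 n2; have [? ? ? ?] := ab0 n1 n2; split; rewrite ?fmorph_eq0.
- move=> n1 n2; rewrite dP -!rmorphM.
  have [c1 _] := gauss_compatibility net E E' n1 n2.
  have [a0 _ _ _] := ab0 n1 (n2 + 1).
  by split; rewrite ?divfK //; congr (phi _); rewrite mulrAC [b _ _ * _]mulrC -c1 mulrC mulKf.
- by move=> n1 n2; have [k0 k1 k2] := kP n1 n2; rewrite -!rmorphM k1 k2 fmorph_eq0.
pose ga n1 n2 := al n1 n2 * be n1 n2 / d n1 n2.
have nz n1 n2 : [/\ l n1 n2 != 0, al n1 n2 != 0, be n1 n2 != 0 & ga n1 n2 != 0].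
  by have [[? ? ?] _ _ _ _] := framP n1 n2; rewrite /ga !mulf_neq0 ?invr_eq0.
have al2 n1 n2 : al n1 (n2 + 1) = ga n1 n2 / be n1 n2.
  have [[_ _ be0] _ [dal _] _ _] := framP n1 n2.
  by rewrite /ga -dal; field; rewrite be0 d0.
have be1 n1 n2 : be (n1 + 1) n2 = ga n1 n2 / al n1 n2.
  have [[_ al0 _] _ [_ dbe] _ _] := framP n1 n2.
  by rewrite /ga -dbe; field; rewrite al0 d0.
exists (fun n1 n2 => l n1 n2 *: map_mx phi (s n1 n2)), al, be, ga.
rewrite /sh12 /sh1 /sh2; split.
- by exists l => n1 n2; split=> //; case: (nz n1 n2).
- by move=> n1 n2; case: (nz n1 n2).
- by [].
(* The entries of L and M that are not prescribed, read off from the rescaled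
   Gauss equations. *)
- exists (fun n1 n2 => al (n1 + 1) n2 * l (n1 + 1 + 1) n2 * phi (x n1 n2)
              / (al n1 n2 * l (n1 + 1) n2)),
    (fun n1 n2 => ga (n1 + 1) n2 * l (n1 + 1 + 1) (n2 + 1) * phi (h n1 n2)
              / (ga n1 n2 * l (n1 + 1) (n2 + 1))),
    (fun n1 n2 => ga (n1 + 1) n2 * l (n1 + 1 + 1) (n2 + 1) * phi (g n1 n2)
              / (al n1 n2 * l (n1 + 1) n2)),
    (fun n1 n2 => al (n1 + 1) n2 * l (n1 + 1 + 1) n2 * phi (y n1 n2)
              / (ga n1 n2 * l (n1 + 1) (n2 + 1))),
    (fun n1 n2 => be n1 (n2 + 1) * l n1 (n2 + 1 + 1) * phi (x' n2 n1)
              / (be n1 n2 * l n1 (n2 + 1))),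
    (fun n1 n2 => ga n1 (n2 + 1) * l (n1 + 1) (n2 + 1 + 1) * phi (h' n2 n1)
              / (ga n1 n2 * l (n1 + 1) (n2 + 1))),
    (fun n1 n2 => ga n1 (n2 + 1) * l (n1 + 1) (n2 + 1 + 1) * phi (g' n2 n1)
              / (be n1 n2 * l n1 (n2 + 1))),
    (fun n1 n2 => be n1 (n2 + 1) * l n1 (n2 + 1 + 1) * phi (y' n2 n1)
              / (ga n1 n2 * l (n1 + 1) (n2 + 1))).
  move=> n1 n2; have [l0 al0 be0 ga0] := nz n1 n2.
  have [l10 _ _ _] := nz (n1 + 1) n2; have [l20 _ _ _] := nz n1 (n2 + 1).
  have [l120 _ _ _] := nz (n1 + 1) (n2 + 1).
  have [_ lE [dal dbe] alE beE] := framP n1 n2.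
  have [_ l1E _ _ _] := framP (n1 + 1) n2; have [_ l2E _ _ _] := framP n1 (n2 + 1).
  have [_ kk1 kk2] := kP n1 n2.
  (* gamma = alpha beta / d, whence gamma_1 = alpha_1 beta_1 / d_1. *)
  have gaE1 : ga (n1 + 1) n2 * l (n1 + 1 + 1) (n2 + 1) * phi (b n1 n2) =
      - (al n1 n2 * be n1 n2 * l n1 (n2 + 1)).
    apply: (gamma_step l0 l10 (d0 (n1 + 1) n2) lE l1E _ dbe alE).
    by rewrite -!rmorphM kk1.
  have gaE2 : ga n1 (n2 + 1) * l (n1 + 1) (n2 + 1 + 1) * phi (b' n1 n2) =
      - (be n1 n2 * al n1 n2 * l (n1 + 1) n2).
    rewrite mulrAC in lE; rewrite mulrAC in l2E.
    rewrite /ga [al n1 (n2 + 1) * _]mulrC.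
    apply: (gamma_step l0 l20 (d0 n1 (n2 + 1)) lE l2E _ dal beE).
    by rewrite -!rmorphM kk2.
  have [e11 e112 _ _] := gauss_map phi E n1 n2.
  have [e22 e122 _ _] := gauss_map phi E' n2 n1.
  have [F11 F112] := frame_derivatives e11 e112 l10 l120 al0 ga0 alE gaE1.
  have [F22 F122] := frame_derivatives e22 e122 l20 l120 be0 ga0 beE gaE2.
  rewrite /Lmx /Mmx !mx4_mul_rows4 /=; split; congr (rows4 _ _ _ _).
  + exact: comb4_unit1.
  + exact: F11.
  + by rewrite be1 -comb4_unit3.
  + exact: F112.
  + by rewrite -comb4_swap -comb4_unit1.
  + by rewrite al2 -comb4_unit3.
  + by rewrite -comb4_swap; exact: F22.
  + by rewrite -comb4_swap; exact: F122.
exists Q; split; first exact: Lie_quadrics_lattice net E E' kP quadQ.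
move=> n1 n2; have [l0 al0 be0 ga0] := nz n1 n2.
have [l10 _ _ _] := nz (n1 + 1) n2; have [l20 _ _ _] := nz n1 (n2 + 1).
have [l120 _ _ _] := nz (n1 + 1) (n2 + 1).
rewrite !scalerA; apply: (@edge_quadric_parametrised _ _ _ _ _ _
  (l n1 n2 * (ga n1 n2 * l (n1 + 1) (n2 + 1)))) => //.
- by rewrite free4_scale ?free4_map // mulf_neq0.
- by rewrite mulf_neq0 // mulf_neq0.
have := edge_quadric_scale (l n1 n2) (al n1 n2 * l (n1 + 1) n2)
  (be n1 n2 * l n1 (n2 + 1)) (ga n1 n2 * l (n1 + 1) (n2 + 1))
  (edge_quadric_map phi (quadQ n1 n2)).
have [_ lE _ _ _] := framP n1 n2.
rewrite rmorph1 rmorphN mulr1 mulrN.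
have -> // : al n1 n2 * l (n1 + 1) n2 * (be n1 n2 * l n1 (n2 + 1)) * phi (k n1 n2) =
  l n1 n2 * (ga n1 n2 * l (n1 + 1) (n2 + 1)).
by rewrite [RHS]mulrCA lE /ga; field.
Qed.

Theorem theorem3p4 (R : realType) (Sigma : lattice 'rV[R]_4)
    (hSigma : discrete_asymptotic_net Sigma) :
  (nonseparating_stars Sigma ->
     admits_canonical_frame (idfun : {rmorphism R -> R}) Sigma) /\
  admits_canonical_frame (real_complex R : {rmorphism R -> R[i]}) Sigma.
Proof.
have [a [x [y [b [g [h E]]]]]] := gauss_equations_net hSigma.
split=> [nonsep|].
  apply: (canonical_frame_of_sqrt _ hSigma E
    (d := fun n1 n2 => Num.sqrt (b n1 n2 / a n1 (n2 + 1)))) => [|n1 n2].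
    by rewrite pnatr_eq0.
  by rewrite sqr_sqrtr // ltW // (nonseparating_gt0 hSigma nonsep E).
apply: (canonical_frame_of_sqrt _ hSigma E
  (d := fun n1 n2 => sqrtC (real_complex R (b n1 n2 / a n1 (n2 + 1))))) => [|n1 n2].
  by rewrite pnatr_eq0.
exact: sqrtCK.
Qed.
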